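(* Let $n\ge1$ and $r\ge0$ be integers, let $\mathcal A$ be an alphabet with $|\mathcal A|=q\ge2$, suppose $n+r\ge4$, and let $\mathcal C\subseteq\mathcal A^{n+r}$ have $|\mathcal C|=q^n$. If $\mathcal C$ corrects one exact adjacent pair of deletions, then $$(q-1)(n+r-3)\le q^{\,r-1}-q^{\,2-n}.$$ Consequently $r\ge3$ whenever $n\ge3$, and if $n\ge 3$ and $r=3$ then $q\ge n-1$. Moreover, every literal-systematic encoder with $n=2$ information symbols and $r$ redundant symbols that corrects one adjacent burst of length at most two has $r\ge3$. Thus for every $n\ge2$ the least number of redundant symbols (over all alphabets) of a literal-systematic encoder with $n$ information symbols correcting one adjacent burst of length at most two is $3$, and it is attained over some power-of-two alphabet of size less than $(n+2)^4$.
   Context: For a word $z=z_1\cdots z_L$, $1\le r\le L$ and $1\le d\le L-r+1$, put $\mathsf B_{r,d}(z)=z_1\cdots z_{d-1}z_{d+r}\cdots z_L$ (deletion of an adjacent burst of length $r$ starting at $d$); the length-$0$ burst leaves $z$ unchanged. A code $\mathcal C\subseteq\mathcal A^L$ corrects one exact adjacent pair of deletions if the sets $\{\mathsf B_{2,d}(z):1\le d\le L-1\}$, $z\in\mathcal C$, are pairwise disjoint for distinct codewords. It corrects one adjacent burst of length at most two if, for each fixed burst length in $\{0,1,2\}$, distinct codewords have disjoint sets of burst descendants of that length. An encoder $E:\mathcal A^n\to\mathcal A^{n+r}$ is literal-systematic with $r$ redundant symbols if $E(x)=x\,\Vert\,p(x)$ (concatenation) for some map $p:\mathcal A^n\to\mathcal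 A^r$; it corrects a class of errors if its image does. *)

(* Defs.v *)
From HB Require Import structures.
From mathcomp Require Import all_boot all_order all_algebra.

Set Implicit Arguments.
Unset Strict Implicit.
Unset Printing Implicit Defensive.

(* [z] with its positions [d], ..., [d + b - 1] removed; as in the usual
   notation z_1 ... z_L, positions are counted from 1. *)
Definition burst_del (A : Type) (b d : nat) (z : seq A) : seq A :=
  take (d - 1) z ++ drop (d - 1 + b) z.

(* The side condition is d <= L - b + 1, written without truncated
   subtraction: there is no descendant at all when L < b.  For b = 0 the only
   descendant is [z] itself. *)
Definition descendant (A : Type) (b : nat) (z w : seq A) : Prop :=
  exists d : nat,
    [/\ 1 <= d, d + b <= size z + 1 & w = burst_del b d z].

Definition corrects_burst (A : finType) (L b : nat) (C : {set L.-tuple A}) :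
    Prop :=
  forall x y : L.-tuple A, x \in C -> y \in C -> x <> y ->
    forall w : seq A, ~ (descendant b x w /\ descendant b y w).

Definition corrects_adjacent_pair (A : finType) (L : nat)
    (C : {set L.-tuple A}) : Prop :=
  corrects_burst 2 C.

Definition corrects_burst_le2 (A : finType) (L : nat)
    (C : {set L.-tuple A}) : Prop :=
  forall b : nat, b <= 2 -> corrects_burst b C.

Definition literal_systematic (A : finType) (n r : nat)
    (E : n.-tuple A -> (n + r).-tuple A) : Prop :=
  exists p : n.-tuple A -> r.-tuple A,
    forall x : n.-tuple A, E x = [tuple of x ++ p x].

Definition code_of (A : finType) (n L : nat) (E : n.-tuple A -> L.-tuple A) :
    {set L.-tuple A} :=
  [set E x | x : n.-tuple A].

Definition systematic_burst_encoder (A : finType) (n r : nat)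
    (E : n.-tuple A -> (n + r).-tuple A) : Prop :=
  literal_systematic E /\ corrects_burst_le2 (code_of E).

(* Alphabets are finite with at least two symbols: over a one-letter alphabet
   r = 0 would trivially work. *)
Definition achievable_redundancy (n r : nat) : Prop :=
  exists A : finType, 2 <= #|A| /\
    exists E : n.-tuple A -> (n + r).-tuple A, systematic_burst_encoder E.

Definition is_least (P : nat -> Prop) (m : nat) : Prop :=
  P m /\ forall k : nat, P k -> m <= k.

(* Main.v *)
(** For the upper bound, give a word w the weight 1 / (1 + c(w)), where c(w) is
the number of i with w_i <> w_(i+2).  A word z has at least 1 + c(z) distinct
descendants under deletion of an adjacent pair, and c does not increase under
such a deletion, so the descendants of z have total weight at least 1; hence a
code is no larger than the total weight of all words of length L - 2, which a
binomial sum evaluates.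

For the construction, append to x two symbols making the sums over the odd and
over the even positions vanish, giving u(x).  A word u(x) is then determined
after deletion of at most two adjacent symbols at a known place, so u(x) shares
a descendant with u(y) for at most 2(n+2)^2 words y.  If the third
symbol f(x) survives the bursts in x and y, a conflict forces f(x) = f(y); if it
survives only in x, the conflict forces f(x) to be a check symbol of y.  In
either case u(x) and u(y) share a descendant.  So f only has to be a greedy
colouring which avoids at most 6(n+2)^2 symbols at each x. *)

Require Import Defs.
From HB Require Import structures.
From mathcomp Require Import all_boot all_order all_algebra.
From mathcomp Require Import zify ring.

Set Implicit Arguments.
Unset Strict Implicit.
Unset Printing Implicit Defensive.

Import Order.TTheory GRing.Theory Num.Theory.

(** * Pair deletions and symbol changes at distance two *)

Lemma size_burst_del (A : Type) (b d : nat) (z : seq A) :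
  1 <= d -> d + b <= size z + 1 -> size (burst_del b d z) = size z - b.
Proof. by move=> d1 db; rewrite size_cat size_take_min size_drop; lia. Qed.

Lemma burst_del_cons (A : Type) (b d : nat) (a : A) (z : seq A) :
  1 <= d -> burst_del b d.+1 (a :: z) = a :: burst_del b d z.
Proof. by case: d => // d _; rewrite /burst_del !subSS !subn0. Qed.

Lemma descendant_cons (A : Type) (b : nat) (a : A) (z w : seq A) :
  descendant b z w -> descendant b (a :: z) (a :: w).
Proof.
move=> [d [d1 db ->]]; exists d.+1; split=> //.
by rewrite burst_del_cons.
Qed.

Fixpoint shift2_changes (A : eqType) (s : seq A) : nat :=
  if s is a :: s' then
    (if s' is _ :: c :: _ then (a != c : nat) else 0) + shift2_changes s'
  else 0.

(** By induction, the descendants of the tail, each prefixed by [a], are distinct. Deleting the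
    first two symbols gives a word starting with [c], which is new exactly when [c] differs from
    [a]. *)
Lemma descendant2_many (A : eqType) (z : seq A) : 2 <= size z ->
  exists ws : seq (seq A), [/\ uniq ws, size ws = (shift2_changes z).+1
    & forall w, w \in ws -> descendant 2 z w].
Proof.
elim: z => [//|a [//|b [|c t]] IH] _.
  exists [:: [::]]; split=> // w; rewrite inE => /eqP ->.
  by exists 1.
have [//|ws [Uws Sws Dws]] := IH.
have Ua : uniq (map (cons a) ws) by rewrite map_inj_uniq // => ? ? [].
have Da w : w \in map (cons a) ws -> descendant 2 [:: a, b, c & t] w.
  by move=> /mapP[v /Dws Dv ->]; apply: descendant_cons.
case: (eqVneq a c) => [eac|nac].
  by exists (map (cons a) ws); split; rewrite ?size_map ?Sws //= -eac eqxx.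
exists ((c :: t) :: map (cons a) ws); split=> /=.
- rewrite Ua andbT; apply/mapP => -[v _ [eca _]].
  by rewrite eca eqxx in nac.
- by rewrite size_map Sws /= nac.
- move=> w; rewrite inE => /orP[/eqP ->|/Da //].
  by exists 1; rewrite /burst_del /=; split=> //; lia.
Qed.

(** Across the gap, two comparisons at distance two merge into one, which the triangle inequality
    bounds. If [d] is at least 4, the first three symbols stay and induction applies. *)
Lemma shift2_changes_burst_del (A : eqType) (d : nat) (z : seq A) :
  1 <= d -> d + 2 <= size z + 1 ->
  shift2_changes (burst_del 2 d z) <= shift2_changes z.
Proof.
have triangle (u v w : A) : (u != w : nat) <= (u != v) + (v != w).
  by case: (eqVneq u v) => [->|] //; case: (u != w).
elim: z d => [|a z IH] [//|[|[|[|d]]]] _ dz; try by move: dz => /=; lia.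
- case: z dz {IH} => [|b [|c t]] //= _.
  by rewrite /burst_del /=; lia.
- case: z dz {IH} => [|b [|c [|e [|f t]]]] //= _; rewrite /burst_del /=; try lia.
  by have := triangle a c f; lia.
- case: z dz {IH} => [|b [|c [|e [|f [|g t]]]]] //= _; rewrite /burst_del /=;
    try lia.
    by have := triangle a c f; lia.
  by have := triangle a c f; have := triangle b e g; lia.
- have dz' : d.+3 + 2 <= size z + 1 by move: dz => /=; lia.
  have {IH} := IH d.+3 isT dz'; rewrite burst_del_cons //.
  case: z dz {dz'} => [|b [|c z]] /= dz; try lia.
Qed.

(** * The total weight as a binomial sum *)

Lemma big_tuple_cons (A : finType) (R : nmodType) (n : nat)
    (F : seq A -> R) :
  (\sum_(w : n.+1.-tuple A) F w =
   \sum_(t : n.-tuple A) \sum_(a : A) F (a :: t))%R.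
Proof.
rewrite exchange_big /= pair_big /=.
rewrite (reindex (fun p : A * n.-tuple A => [tuple of p.1 :: p.2])) //.
exists (fun w : n.+1.-tuple A => (thead w, [tuple of behead w])) => [[a t]|w] _ /=.
  by rewrite theadE; congr pair; apply: val_inj.
by rewrite [RHS]tuple_eta; apply: val_inj.
Qed.

(** Pascal's rule, written as the replacement of [h] that prepending one letter to a word causes. *)
Lemma binomial_sumS (R : comNzRingType) (c : R) (h : nat -> R) (M : nat) :
  (\sum_(k < M.+2) 'C(M.+1, k)%:R * c ^+ k * h k =
   \sum_(k < M.+1) 'C(M, k)%:R * c ^+ k * (h k + c * h k.+1))%R.
Proof.
have -> : (\sum_(k < M.+1) 'C(M, k)%:R * c ^+ k * (h k + c * h k.+1) =
    \sum_(k < M.+1) 'C(M, k)%:R * c ^+ k * h k +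
    \sum_(k < M.+1) 'C(M, k)%:R * c ^+ k.+1 * h k.+1)%R.
  by rewrite -big_split; apply: eq_bigr => k _ /=; rewrite exprS; ring.
have -> : (\sum_(k < M.+1) 'C(M, k)%:R * c ^+ k * h k =
    h 0 + \sum_(k < M.+1) 'C(M, k.+1)%:R * c ^+ k.+1 * h k.+1)%R.
  rewrite [in RHS]big_ord_recr /= bin_small // !mul0r addr0 big_ord_recl /=.
  by rewrite bin0 expr0 !mul1r.
rewrite big_ord_recl /= bin0 expr0 !mul1r -addrA -big_split /=; congr (_ + _)%R.
by apply: eq_bigr => k _; rewrite /bump /= add1n binS natrD; ring.
Qed.

(** A prepended letter either equals the symbol two places on, or is one of the other [#|A| - 1]
    letters and raises the count by one. The induction changes [h], so [h] is arbitrary. *)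
Lemma sum_shift2_changes (A : finType) (R : comNzRingType) (h : nat -> R) (M : nat) :
  (\sum_(w : M.+2.-tuple A) h (shift2_changes w) =
   #|A|%:R ^+ 2 * \sum_(k < M.+1) 'C(M, k)%:R * (#|A|%:R - 1) ^+ k * h k)%R.
Proof.
elim: M h => [|M IH] h.
  rewrite big_ord1 bin0 expr0 !mul1r.
  rewrite (eq_bigr (fun=> h 0)) => [|w _].
    by rewrite sumr_const card_tuple -natrX mulr_natl.
  by case: w => [[|a [|b []]]].
rewrite binomial_sumS -(IH (fun k => h k + (#|A|%:R - 1) * h k.+1)%R).
rewrite (big_tuple_cons _ (fun w => h (shift2_changes w))); apply: eq_bigr => -[s Ss] _ /=.
case: s Ss => [|b [|c s]] //= _.
rewrite (bigD1 c) //= eqxx add0n; congr (_ + _)%R.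
rewrite (eq_bigr (fun=> h (shift2_changes [:: b, c & s]).+1)) => [|a ac].
  rewrite sumr_const -[LHS]mulr_natl; congr (_ * _)%R.
  by rewrite cardC1 -subn1 natrB //; apply/card_gt0P; exists b.
by rewrite ac add1n.
Qed.

Lemma sum_inv_shift2_changes (A : finType) (M : nat) : 1 <= #|A| ->
  ((#|A|%:R - 1) * M.+1%:R *
     \sum_(w : M.+2.-tuple A) (shift2_changes w).+1%:R^-1 =
   #|A|%:R ^+ 2 * (#|A|%:R ^+ M.+1 - 1) :> rat)%R.
Proof.
move=> A1; rewrite (sum_shift2_changes _ (fun k => k.+1%:R^-1)%R) mulrCA; congr (_ * _)%R.
set c := (#|A|%:R - 1)%R.
have -> : (#|A|%:R = 1 + c :> rat)%R by rewrite /c; ring.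
rewrite exprDn [in RHS]big_ord_recl /= expr1n bin0 expr0 mulr1 mulr1n addrAC subrr add0r.
rewrite mulr_sumr; apply: eq_bigr => k _.
rewrite /bump /= add1n expr1n mul1r exprS -[RHS]mulr_natl.
(* The factor 1/(k+1) is absorbed by C(M+1,k+1) = (M+1) C(M,k) / (k+1), leaving the binomial
   expansion of (1+c)^(M+1) without its constant term. *)
have := mul_bin_diag M.+1 k => /= /(congr1 (fun n => n%:R : rat)%R).
rewrite !natrM => E.
have k0 : (k.+1%:R != 0 :> rat)%R by rewrite pnatr_eq0.
have -> : ('C(M.+1, k.+1)%:R = M.+1%:R * 'C(M, k)%:R / k.+1%:R :> rat)%R.
  by rewrite E mulrC mulKf.
by ring.
Qed.

(** * The upper bound on codes and its consequences for redundancy *)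

Definition descendantb (A : eqType) (b : nat) (z w : seq A) : bool :=
  has (fun d => w == burst_del b d z) (iota 1 (size z + 1 - b)).

Lemma descendantP (A : eqType) (b : nat) (z w : seq A) :
  reflect (descendant b z w) (descendantb b z w).
Proof.
apply: (iffP hasP) => [[d]|[d [d1 db ->]]].
  by rewrite mem_iota => dP /eqP ->; exists d; split=> //; lia.
by exists d => //; rewrite mem_iota; lia.
Qed.

Lemma descendant2_weight (A : finType) (M : nat) (z : M.+4.-tuple A) :
  (1 <= \sum_(w : M.+2.-tuple A | descendantb 2 z w)
          (shift2_changes w).+1%:R^-1 :> rat)%R.
Proof.
have [|ws [Uws Sws Dws]] := @descendant2_many A z; first by rewrite size_tuple.
pose D := [pred w : M.+2.-tuple A | descendantb 2 z w].
have cD : (shift2_changes z).+1 <= #|D|.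
  rewrite -Sws cardE -(size_map val); apply: uniq_leq_size => // w /Dws dw.
  have sw : size w == M.+2.
    by case: dw => d [d1 db ->]; rewrite size_burst_del // size_tuple.
  apply/mapP; exists (Tuple sw) => //.
  by rewrite mem_enum inE; apply/descendantP.
have : (\sum_(w in D) (shift2_changes z).+1%:R^-1 <=
    \sum_(w : M.+2.-tuple A | descendantb 2 z w)
          (shift2_changes w).+1%:R^-1 :> rat)%R.
  apply: ler_sum => w /descendantP [d [d1 db ->]].
  by rewrite lef_pV2 ?posrE ?ltr0n // ler_nat ltnS shift2_changes_burst_del.
apply: le_trans; rewrite sumr_const -[leRHS]mulr_natl.
by rewrite ler_pdivlMr ?ltr0n // mul1r ler_nat.
Qed.

(* Double counting: every codeword has descendants of total weight at least 1,
   and every word is a descendant of at most one codeword. *)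
Lemma adjacent_pair_code_bound (A : finType) (L : nat) (C : {set L.-tuple A}) :
  1 <= #|A| -> 4 <= L -> corrects_adjacent_pair C ->
  (#|C|%:R * ((#|A|%:R - 1) * (L%:R - 3))
     <= #|A|%:R ^+ (L - 1) - #|A|%:R ^+ 2 :> rat)%R.
Proof.
case: L C => [|[|[|[|M]]]] // C A1 _ hC.
have le_sum : (#|C|%:R <=
    \sum_(w : M.+2.-tuple A) (shift2_changes w).+1%:R^-1 :> rat)%R.
  apply: le_trans (_ : \sum_(z in C) \sum_(w : M.+2.-tuple A | descendantb 2 z w)
      (shift2_changes w).+1%:R^-1 <= _)%R.
    rewrite -sum1_card natr_sum; apply: ler_sum => z _.
    exact: descendant2_weight.
  rewrite (exchange_big_dep predT) //=; apply: ler_sum => w _.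
  rewrite sumr_const -[leLHS]mulr_natl ler_piMl ?invr_ge0 // -[1%R]/(1%:R)%R ler_nat.
  apply/card_le1_eqP => y x.
rewrite /in_mem /=.
  move=> /andP[Cy /descendantP dy] /andP[Cx /descendantP dx].
  by apply/eqP; case: eqP => // ne; case: (hC x y Cx Cy ne w).
have -> : (M.+4%:R - 3 = M.+1%:R :> rat)%R by rewrite -natrB.
have -> : (#|A|%:R ^+ (M.+4 - 1) - #|A|%:R ^+ 2 =
    #|A|%:R ^+ 2 * (#|A|%:R ^+ M.+1 - 1) :> rat)%R.
  by rewrite subn1 /= -(addn2 M.+1) exprD; ring.
rewrite -sum_inv_shift2_changes // mulrC ler_wpM2l // mulr_ge0 ?ler0n //.
by rewrite subr_ge0 -[1%R]/(1%:R)%R ler_nat.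
Qed.

Lemma adjacent_pair_redundancy (n r q : nat) (A : finType)
    (C : {set (n + r).-tuple A}) :
  1 <= n -> #|A| = q -> 2 <= q -> 4 <= n + r -> #|C| = q ^ n ->
  corrects_adjacent_pair C ->
  [/\ ((q%:R - 1) * ((n + r)%:R - 3)
         <= q%:R ^ (r%:Z - 1) - q%:R ^ (2 - n%:Z) :> rat)%R,
      3 <= n -> 3 <= r
    & 3 <= n -> r = 3 -> n - 1 <= q].
Proof.
move=> n1 Aq q2 nr4 Cq hC.
have := adjacent_pair_code_bound _ nr4 hC; rewrite Aq Cq => /(_ (ltnW q2)) bound.
have q0 : (0 < q%:R :> rat)%R by rewrite ltr0n ltnW.
have qn0 : (q%:R != 0 :> rat)%R by rewrite gt_eqF.
have main : ((q%:R - 1) * ((n + r)%:R - 3)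
         <= q%:R ^ (r%:Z - 1) - q%:R ^ (2 - n%:Z) :> rat)%R.
  have qn : (0 < q%:R ^+ n :> rat)%R by rewrite exprn_gt0.
  rewrite -(ler_pM2l qn) [leRHS]mulrBr [in leRHS](exprnP _ n) -!expfzDr //.
  have -> : (n%:Z + (r%:Z - 1) = (n + r - 1)%N%:Z)%R by lia.
  have -> : (n%:Z + (2 - n%:Z) = 2%N%:Z)%R by lia.
  by move: bound; rewrite natrX.
have bnat : (q - 1) * (n + r - 3) * q ^ n + q ^ 2 <= q ^ (n + r - 1).
  move: bound; rewrite lerBrDr -!natrX => bound.
  rewrite -(ler_nat rat) natrD; apply: le_trans bound.
  rewrite !natrM !natrB //; [|lia|lia].
  by rewrite le_eqVlt; apply/orP; left; apply/eqP; ring.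
have qnn : 0 < q ^ n by rewrite expn_gt0 ltnW.
split=> // n3.
  rewrite ltnNge; apply/negP => r2.
  (* The term [q ^ 2] makes [bnat] strict. It fails for [r <= 1] because the factor of [q ^ n] is
     positive, and for [r = 2] because q <= (q-1)(n-1). *)
  have [r1|{}r2] : r <= 1 \/ r = 2 by lia.
    have : q ^ (n + r - 1) <= q ^ n by rewrite leq_pexp2l //; lia.
    have : q ^ n <= (q - 1) * (n + r - 3) * q ^ n.
      by rewrite leq_pmull // muln_gt0; lia.
    have : 0 < q ^ 2 by rewrite expn_gt0 ltnW.
    by lia.
  move: bnat; rewrite r2 (_ : n + 2 - 1 = n.+1) ?expnS; last by lia.
  have : q * q ^ n <= (q - 1) * (n + 2 - 3) * q ^ n.
    by rewrite leq_pmul2r //; nia.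
  by nia.
move=> r3; rewrite leqNgt; apply/negP => qn.
move: bnat; rewrite r3 (_ : n + 3 - 1 = n.+2) ?expnS; last by lia.
(* Here n >= q+2, and (q-1)(q+2) = q^2 + q - 2. *)
have : q * q <= (q - 1) * (n + 3 - 3) by nia.
rewrite -(leq_pmul2r qnn) mulnA.
by nia.
Qed.

(** * Lower bounds for systematic encoders *)

Lemma systematic_no_conflict (A : finType) (n r : nat)
    (E : n.-tuple A -> (n + r).-tuple A) (b : nat) (x y : n.-tuple A) (w : seq A) :
  systematic_burst_encoder E -> b <= 2 ->
  descendant b (E x) w -> descendant b (E y) w -> x = y.
Proof.
move=> [[p Ep] hE] b2 dx dy.
have injE : injective E.
  move=> x' y'; rewrite !Ep => /(congr1 val) /= /(congr1 (take n)).
  by rewrite !take_size_cat ?size_tuple // => /val_inj.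
apply/eqP; case: eqP => // nxy.
by case: (hE b b2 (E x) (E y) _ _ _ w); rewrite ?imset_f // => /injE.
Qed.

(** Secures [4 <= n + r] for the counting bound when n = 3. Without redundancy, words differing only
    in their first symbol agree once the first pair is deleted. *)
Lemma systematic_redundancy_gt0 (A : finType) (n r : nat)
    (E : n.-tuple A -> (n + r).-tuple A) :
  2 <= n -> 2 <= #|A| -> systematic_burst_encoder E -> 1 <= r.
Proof.
move=> n2 /card_gt1P [a [b [_ _ nab]]] hE; case: r E hE => // E hE.
case: n n2 E hE => [|[|n]] // _ E hE.
have Ev x : E x = x :> seq A.
  by have [[p ->] _] := hE; rewrite /= (size0nil (size_tuple (p x))) cats0.
pose X c := [tuple of c :: nseq n.+1 a].
have D c : descendant 2 (E (X c)) (nseq n a).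
  exists 1; rewrite Ev /burst_del /= drop0 ?size_nseq; split=> //; lia.
have /(congr1 (@thead _ _)) := systematic_no_conflict (b := 2) hE isT (D a) (D b).
by move=> eab; rewrite [a]eab eqxx in nab.
Qed.

(** For n = r = 2 the counting bound holds with equality, so single deletions are needed too. Pair
    deletions force the codewords uvuv, but abab and baba share the descendant bab. *)
Lemma systematic_redundancy_two (A : finType) (r : nat)
    (E : 2.-tuple A -> (2 + r).-tuple A) :
  2 <= #|A| -> systematic_burst_encoder E -> 3 <= r.
Proof.
move=> cA hE; have r0 := systematic_redundancy_gt0 (n := 2) isT cA hE.
case/card_gt1P: cA => [a [b [_ _ nab]]].
have [[p Ep] _] := hE.
case: r E p hE Ep r0 => [|[|[|r]]] // E p hE Ep _.
- have D c : descendant 2 (E [tuple a; c]) [:: a].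
    exists 2; rewrite Ep /=; split=> //; first by rewrite size_tuple.
    by case: (p _) => [[|e []]].
  have := systematic_no_conflict (b := 2) hE isT (D a) (D b).
  by move=> /(congr1 val) [eab]; rewrite eab eqxx in nab.
- (* Every pair w is the information part of a codeword, hence already its
     descendant, so the descendants of E x all equal x. *)
  have own x (w : 2.-tuple A) : descendant 2 (E x) w -> w = x.
    move=> dw; apply: (systematic_no_conflict (b := 2) hE isT _ dw).
    exists 3; rewrite size_tuple; split=> //.
    rewrite Ep /burst_del /= take_size_cat ?size_tuple //.
    by rewrite drop_oversize ?cats0 // size_cat !size_tuple.
  have Ev u v : E [tuple u; v] = [:: u; v; u; v] :> seq A.
    move: (own [tuple u; v]); rewrite Ep /=.
    case: (p _) => [[|s [|t []]]] //= _ own_uv.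
    have /(congr1 val) [<-] : [tuple u; t] = [tuple u; v].
      by apply: own_uv; exists 2.
    have /(congr1 val) [<-] // : [tuple s; t] = [tuple u; v].
    by apply: own_uv; exists 1.
  have /(congr1 val) [eab _] : [tuple a; b] = [tuple b; a].
    apply: (systematic_no_conflict (b := 1) (w := [:: b; a; b]) hE isT).
      by exists 1; rewrite Ev.
    by exists 4; rewrite Ev.
  by rewrite eab eqxx in nab.
Qed.

Lemma systematic_redundancy_ge3 (A : finType) (n r : nat)
    (E : n.-tuple A -> (n + r).-tuple A) :
  2 <= n -> 2 <= #|A| -> systematic_burst_encoder E -> 3 <= r.
Proof.
case: (ltngtP n 2) => // [n3 _|n2]; last first.
  by subst n => _; apply: systematic_redundancy_two.
move=> cA hE; have r0 := systematic_redundancy_gt0 (ltnW n3) cA hE.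
have injE : injective E.
  move=> x y exy; have D z : descendant 0 (E z) (E z).
    by exists 1; rewrite /burst_del take0 drop0; split=> //; lia.
  by apply: (systematic_no_conflict (b := 0) hE isT (D x)); rewrite exy.
have cE : #|code_of E| = #|A| ^ n by rewrite card_imset // card_tuple.
have hC : corrects_adjacent_pair (code_of E) by apply: (proj2 hE).
have [|| _ /(_ n3) //] := @adjacent_pair_redundancy n r _ A _ _ erefl cA _ cE hC.
- by lia.
- by lia.
Qed.

(** * Two parity checks and erasures at a known place *)

Lemma nth_burst_del (A : Type) (x0 : A) (b d i : nat) (z : seq A) :
  1 <= d -> d + b <= size z + 1 ->
  nth x0 (burst_del b d z) i = nth x0 z (if i < d - 1 then i else i + b).
Proof.
move=> d1 db; rewrite nth_cat size_take_min (_ : minn _ _ = d - 1); last by lia.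
case: ltnP => id; first by rewrite nth_take.
by rewrite nth_drop; congr nth; lia.
Qed.

Definition parity_balanced (A : zmodType) (s : seq A) : Prop :=
  forall e : bool, (\sum_(i < size s | odd i == e) s`_i = 0)%R.

(** At most two adjacent positions are lost, hence at most one of each parity, and its symbol is
    determined by the vanishing sum of that parity class. *)
Lemma parity_balanced_erasure (A : zmodType) (b d : nat) (s t : seq A) :
  parity_balanced s -> parity_balanced t -> size s = size t ->
  b <= 2 -> 1 <= d -> d + b <= size s + 1 ->
  burst_del b d s = burst_del b d t -> s = t.
Proof.
move=> bs bt st b2 d1 db E.
have out i : (i < d - 1) || (d - 1 + b <= i) -> (s`_i = t`_i)%R.
  have N j := congr1 (fun w => nth 0%R w j) E.
  case/orP => Hi.
    by have := N i; rewrite /= !nth_burst_del -?st // Hi.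
  have := N (i - b); rewrite /= !nth_burst_del -?st //.
  by rewrite ifF ?subnK //; lia.
apply: (@eq_from_nth _ 0%R) => // j js.
case: (boolP ((j < d - 1) || (d - 1 + b <= j))) => [/out //|Hj].
have eq_rest : (\sum_(i < size s | (odd i == odd j) && (i != Ordinal js)) s`_i =
    \sum_(i < size s | (odd i == odd j) && (i != Ordinal js)) t`_i)%R.
  apply: eq_bigr => i /andP[/eqP oij nij]; apply: out.
  have nij' : i <> j :> nat by move=> e; case/eqP: nij; apply: val_inj.
  by move: Hj; lia.
have := bt (odd j); have := bs (odd j); rewrite -st.
rewrite !(bigD1 (P := fun i : 'I_(size s) => odd i == odd j) (Ordinal js)) //=.
by rewrite eq_rest => e1 e2; apply: (addIr _ (etrans e1 (esym e2))).
Qed.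

(** The two symbols will stand at indices [size x] and [size x + 1], so the first repairs the parity
    class of [size x] and the second the other class. *)
Definition check2 (A : zmodType) (x : seq A) : seq A :=
  [:: - (\sum_(i < size x | odd i == odd (size x)) x`_i);
      - (\sum_(i < size x | odd i == ~~ odd (size x)) x`_i)]%R.

Lemma parity_balanced_check2 (A : zmodType) (x : seq A) :
  parity_balanced (x ++ check2 x).
Proof.
move=> e; rewrite size_cat addn2 big_mkcond !big_ord_recr /=.
rewrite !nth_cat ltnn subnn ltnNge leqnSn subSnn /=.
rewrite (eq_bigr (fun i : 'I_(size x) => if odd i == e then x`_i else 0)%R); last first.
  by move=> i _; rewrite nth_cat ltn_ord.
rewrite -big_mkcond /=.
case: e; case: (odd (size x)) => /=; rewrite ?addr0 ?subrr //.
Qed.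

(** * Greedy colouring and the conflict graph *)

Lemma list_greedy_coloring (V K : finType) (e : rel V) (forb : V -> {set K})
    (k0 : K) :
  symmetric e ->
  (forall x, #|forb x| + #|[set y | e x y]| < #|K|) ->
  exists f : V -> K, (forall x, f x \notin forb x) /\
    (forall x y, x != y -> e x y -> f x != f y).
Proof.
move=> esym hK.
suff [f hf] : exists f : V -> K, forall x, x \in enum V ->
    f x \notin forb x /\ forall y, y \in enum V -> x != y -> e x y -> f x != f y.
  by exists f; split=> [x|x y]; have [|fx h] := hf x; rewrite ?mem_enum //;
    apply: h; rewrite mem_enum.
elim: (enum V) => [|x s [f IH]]; first by exists (fun=> k0).
(* The new colour avoids [f] on all neighbours, even those not yet treated; the degree bound allows
   for this. *)
have [k] : exists k, k \notin forb x :|: f @: [set y | e x y].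
  apply/existsP; rewrite -negb_forall; apply/negP => /forallP all_in.
  have : #|K| <= #|forb x :|: f @: [set y | e x y]|.
    by apply: subset_leq_card; apply/subsetP.
  apply/negP; rewrite -ltnNge; apply: leq_ltn_trans (hK x).
  by apply: leq_trans (leq_card_setU _ _) _; rewrite leq_add2l leq_imset_card.
rewrite inE negb_or => /andP[kx kN].
have fresh y : e x y -> k != f y.
  by move=> exy; apply: contraNneq kN => ->; rewrite imset_f // inE.
exists (fun z => if z == x then k else f z) => z; rewrite inE.
case: (eqVneq z x) => [-> _|nzx /= zs].
  split=> // y; rewrite inE; case: (eqVneq y x) => [->|_ _ _]; first by rewrite eqxx.
  exact: fresh.
have [fz hz] := IH z zs; split=> // y; rewrite inE.
case: (eqVneq y x) => [-> _ _|nyx /= ys]; last exact: hz.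
by rewrite esym eq_sym; apply: fresh.
Qed.

(** For words of length [N]: a common descendant under a burst of length 1 or 2. The boolean encodes
    the length minus one, the ordinals the two starts counted from 0. *)
Definition near (A : eqType) (N : nat) (s t : seq A) : bool :=
  [exists u : bool * 'I_N * 'I_N,
    [&& u.1.2 + u.1.1.+1 <= N, u.2 + u.1.1.+1 <= N
      & burst_del u.1.1.+1 u.1.2.+1 s == burst_del u.1.1.+1 u.2.+1 t]].

Lemma near_sym (A : eqType) (N : nat) : symmetric (@near A N).
Proof.
suff h (s t : seq A) : near N s t -> near N t s by move=> s t; apply/idP/idP; apply: h.
case/existsP=> -[[b d] d'] /and3P[h1 h2 /eqP h3].
by apply/existsP; exists (b, d', d); apply/and3P; split=> //=; rewrite h3.
Qed.

Lemma nearI (A : eqType) (N b d d' : nat) (s t : seq A) :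
  1 <= b <= 2 -> 1 <= d -> d + b <= N + 1 -> 1 <= d' -> d' + b <= N + 1 ->
  burst_del b d s = burst_del b d' t -> near N s t.
Proof.
move=> hb d1 db d'1 d'b E; apply/existsP.
have dN : d.-1 < N by lia.
have d'N : d'.-1 < N by lia.
exists (b == 2, Ordinal dN, Ordinal d'N); rewrite /= (_ : (b == 2).+1 = b); last by lia.
by rewrite !prednK // E eqxx andbT; apply/andP; split; lia.
Qed.

(** Each triple of a burst length and two starts admits at most one [y], by erasure correction, and
    there are [2 * N * N] triples. *)
Lemma near_few (A : finZmodType) (V : finType) (N : nat) (u : V -> seq A) (s : seq A) :
  injective u -> (forall x, size (u x) = N) -> (forall x, parity_balanced (u x)) ->
  #|[set y | near N s (u y)]| <= 2 * N * N.
Proof.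
move=> inju su bu; case: (pickP (@predT V)) => [x0 _|V0]; last first.
  by rewrite eq_card0 // => y; have := V0 y.
pose R (t : bool * 'I_N * 'I_N) y := [&& t.1.2 + t.1.1.+1 <= N, t.2 + t.1.1.+1 <= N
      & burst_del t.1.1.+1 t.1.2.+1 s == burst_del t.1.1.+1 t.2.+1 (u y)].
pose g t := odflt x0 [pick y | R t y].
apply: leq_trans (_ : #|g @: [set: bool * 'I_N * 'I_N]| <= _).
  apply/subset_leq_card/subsetP => y; rewrite inE => /existsP[t Rty].
  apply/imsetP; exists t => //; rewrite /g; case: pickP => [z Rtz|/(_ y)]; last first.
    by rewrite /R Rty.
  apply: inju; case/and3P: Rty Rtz => _ h2 /eqP h3 /and3P[_ _ /eqP].
  rewrite h3; apply: parity_balanced_erasure; rewrite ?su //; first by case: (t.1.1).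
  by lia.
by apply: leq_trans (leq_imset_card _ _) _; rewrite cardsT !card_prod card_bool !card_ord.
Qed.

(** * The encoder with three redundant symbols *)

Lemma burst_del_rcons (A : Type) (b d : nat) (s : seq A) (a : A) :
  1 <= b -> 1 <= d -> d + b <= size s + 2 ->
  burst_del b d (rcons s a) =
    if d + b <= size s + 1 then rcons (burst_del b d s) a
    else take (size s + 1 - b) s.
Proof.
move=> b1 d1 db; rewrite /burst_del -cats1 takel_cat; last by lia.
case: leqP => h.
  rewrite drop_cat -cats1 -catA; case: ltnP => // h'.
  by rewrite (_ : d - 1 + b - size s = 0) ?drop0 ?(@drop_oversize _ _ s) //; lia.
rewrite drop_oversize ?cats0; last by rewrite size_cat /=; lia.
by congr take; lia.
Qed.

Lemma check2_conflict (A : zmodType) (b d d' : nat) (x y : seq A)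
    (a c : A) :
  size x = size y -> 1 <= b <= 2 ->
  1 <= d -> d + b <= size x + 4 -> 1 <= d' -> d' + b <= size x + 4 ->
  d <= d' ->
  burst_del b d (rcons (x ++ check2 x) a) = burst_del b d' (rcons (y ++ check2 y) c) ->
  x = y \/ near (size x + 2) (x ++ check2 x) (y ++ check2 y) /\
            (a = c \/ a \in check2 y).
Proof.
move=> sxy hb d1 db d'1 d'b dd'.
rewrite !burst_del_rcons ?size_cat -?sxy /=; try lia.
case: ifP => h; case: ifP => h'.
- move=> /rcons_inj [E ->]; right; split; last by left.
  exact: nearI hb d1 _ d'1 _ E.
- rewrite (_ : size x + 2 + 1 - b = (size x + 2 - b).+1); last by lia.
  rewrite (take_nth a) ?size_cat -?sxy /=; last by lia.
  move=> /rcons_inj [E ->]; right; split.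
    have E' : burst_del b (size x + 2 + 1 - b) (y ++ check2 y) =
        take (size x + 2 - b) (y ++ check2 y).
      rewrite /burst_del drop_oversize ?cats0 ?size_cat -?sxy /=; last by lia.
      by congr take; lia.
    by apply: (nearI hb d1 _ _ _ (etrans E (esym E'))); lia.
  right; rewrite nth_cat -sxy ltnNge (_ : size x <= _) /=; last by lia.
  by apply: mem_nth => /=; lia.
- by lia.
(* Both bursts lie at the very end and spare the information symbols. *)
- move=> /(congr1 (take (size x))); rewrite !take_takel; try lia.
  by rewrite {2}sxy !take_size_cat //; left.
Qed.

Lemma systematic_burst_encoder3 (A : finZmodType) (n : nat) :
  6 * (n + 2) ^ 2 < #|A| ->
  exists E : n.-tuple A -> (n + 3).-tuple A, systematic_burst_encoder E.
Proof.
move=> hA; pose u (x : n.-tuple A) := x ++ check2 x.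
have inju : injective u.
  move=> x y /(congr1 (take n)); rewrite !take_size_cat ?size_tuple //.
  exact: val_inj.
have su x : size (u x) = n + 2 by rewrite size_cat size_tuple.
pose e x y := near (n + 2) (u x) (u y).
pose forb x := [set k | [exists y, e x y && (k \in check2 y)]].
have [||f [f1 f2]] := @list_greedy_coloring _ _ e forb 0%R.
- by move=> x y; apply: near_sym.
- move=> x.
  have hN : #|[set y | e x y]| <= 2 * (n + 2) * (n + 2).
    exact: near_few inju su (fun y => parity_balanced_check2 y).
  (* Every nearby word forbids its two check symbols and one colour, which gives the factor 6 = 3 *
     2. *)
  have : #|forb x| <= #|[set y | e x y]| + #|[set y | e x y]|.
    have F (i : nat) :
        #|[set nth 0%R (check2 (val y)) i | y in [set y | e x y]]| <= #|[set y | e x y]|.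
      exact: leq_imset_card.
    apply: leq_trans (leq_add (F 0) (F 1)); apply: leq_trans (leq_card_setU _ _).
    apply/subset_leq_card/subsetP => k; rewrite inE => /existsP[y /andP[exy ky]].
    have y_in : y \in [set y | e x y] by rewrite inE.
    move: ky; rewrite !inE => /orP[] /eqP ->; apply/orP; [left|right];
      by apply/imsetP; exists y.
  move: hN; rewrite -mulnA mulnn; move: #|_| #|_| => a c.
  by move: hA; move: ((n + 2) ^ 2) #|A| => P q; clear; lia.
pose p (x : n.-tuple A) := [tuple of rcons (check2 x) (f x)].
pose E (x : n.-tuple A) := [tuple of x ++ p x].
have Ev x : E x = rcons (u x) (f x) :> seq A by rewrite /u -cats1 -catA.
have injE : injective E.
  by move=> x y /(congr1 val); rewrite /= !Ev => /rcons_inj [/inju].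
exists E; split; first by exists p.
move=> b b2 _ _ /imsetP[x _ ->] /imsetP[y _ ->] nxy w.
case=> -[d [d1 db ->]] [d' [d'1 d'b]].
have {}nxy : x <> y by move=> exy; case: nxy; rewrite exy.
case: b b2 db d'b => [|b] b2 db d'b.
  by rewrite /burst_del !addn0 !cat_take_drop => /val_inj/injE.
wlog dd' : x y d d' nxy d1 db d'1 d'b / d <= d'.
  move=> W; case: (leqP d d') => dd' Exy; first exact: W nxy d1 db d'1 d'b dd' Exy.
  exact: W (nesym nxy) d'1 d'b d1 db (ltnW dd') (esym Exy).
rewrite !Ev => Exy; rewrite !size_tuple in db d'b.
have [||||/val_inj //|[nr fxy]] := check2_conflict _ _ d1 _ d'1 _ dd' Exy;
  rewrite ?size_tuple //; try lia.
move: nr; rewrite size_tuple => nr.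
have {}nxy : x != y by apply/eqP.
case: fxy => [fxy|fy]; first by have := f2 x y nxy nr; rewrite fxy eqxx.
have := f1 x; rewrite inE => /existsP[]; exists y.
by rewrite /e nr.
Qed.

(** The largest power of two below (n+2)^4 is at least half of it, hence at least 8(n+2)^2 because
    (n+2)^2 >= 16. *)
Lemma power_of_two_encoder (n : nat) : 2 <= n ->
  exists (m : nat) (A : finType) (E : n.-tuple A -> (n + 3).-tuple A),
    [/\ 1 <= m, #|A| = 2 ^ m, #|A| < (n + 2) ^ 4 & systematic_burst_encoder E].
Proof.
move=> n2; pose N4 := (n + 2) ^ 4; pose m := trunc_log 2 (N4 - 1).
have N4E : N4 = (n + 2) ^ 2 * (n + 2) ^ 2 by rewrite -expnD.
have N2 : 16 <= (n + 2) ^ 2 by rewrite -mulnn; nia.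
have /andP[lo hi] : 2 ^ m <= N4 - 1 < 2 ^ m.+1 by apply: trunc_log_bounds => //; nia.
rewrite expnS in hi.
have m1 : 1 <= m by case: (m) hi => //; nia.
have cA : #|'Z_(2 ^ m)| = 2 ^ m.
  by rewrite card_ord Zp_cast // -{1}(expn0 2) ltn_exp2l.
have [|E hE] := @systematic_burst_encoder3 'Z_(2 ^ m) n; first by rewrite cA; nia.
by exists m, 'Z_(2 ^ m), E; split=> //; rewrite cA; lia.
Qed.

Theorem theorem8p1 :
  (forall (n r q : nat) (A : finType) (C : {set (n + r).-tuple A}),
     1 <= n -> #|A| = q -> 2 <= q -> 4 <= n + r -> #|C| = q ^ n ->
     corrects_adjacent_pair C ->
     [/\ ((q%:R - 1) * ((n + r)%:R - 3)
            <= q%:R ^ (r%:Z - 1) - q%:R ^ (2 - n%:Z) :> rat)%R,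
         3 <= n -> 3 <= r
       & 3 <= n -> r = 3 -> n - 1 <= q])
  /\
  (forall (r : nat) (A : finType) (E : 2.-tuple A -> (2 + r).-tuple A),
     2 <= #|A| -> systematic_burst_encoder E -> 3 <= r)
  /\
  (forall n : nat, 2 <= n ->
     is_least (achievable_redundancy n) 3 /\
     exists (m : nat) (A : finType) (E : n.-tuple A -> (n + 3).-tuple A),
       [/\ 1 <= m, #|A| = 2 ^ m, #|A| < (n + 2) ^ 4
         & systematic_burst_encoder E]).
Proof.
split; first exact: adjacent_pair_redundancy.
split; first by move=> r A E; apply: systematic_redundancy_two.
move=> n n2; have enc := power_of_two_encoder n2; split=> //; split.
  have [m [A [E [m1 cA _ hE]]]] := enc; exists A; split; last by exists E.
  by rewrite cA -{1}(expn1 2) leq_exp2l.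
by move=> k [A [cA [E hE]]]; apply: systematic_redundancy_ge3 n2 cA hE.
Qed.
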